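(* Let $X,Y$ be normed spaces and let $F:X\rightrightarrows Y$ be a set-valued mapping. Let $\emptyset\neq L\subset S_X$, $\emptyset\neq M\subset S_Y$, and let $U\subset X$, $V\subset Y$ be nonempty sets. Let $\gamma$ be a gauge function on $U$ and let $\tau>0$. Then the following assertions are equivalent: (i) $F$ is directionally $\gamma$-regular on $U\times V$ w.r.t. $L$ and $M$ with constant $\tau$; (ii) $F^{-1}$ is directionally $\gamma$-Aubin continuous on $V\times U$ w.r.t. $M$ and $L$ with constant $\tau$; (iii) $F$ is directionally $\gamma$-open on $U\times V$ w.r.t. $L$ and $M$ with constant $\tau^{-1}$.
   Context: For a normed space $Z$, $S_Z$ is its unit sphere and $\mathbf{B}(z,r)$ the open ball. For a set $A$ in a normed space, $\operatorname{cone}A=\{ta: t\ge 0,\ a\in A\}$. For $\emptyset\ne L\subset S_X$ and $A\subset X$, the directional minimal time function is $T_L(x,A):=\inf\{t\ge 0 : (x+tL)\cap A\ne\emptyset\}$, with $\inf\emptyset=+\infty$ (in particular $T_L(x,\emptyset)=+\infty$), and $T_L(x,u):=T_L(x,\{u\})$; similarly for $T_M$ on $Y$. A gauge function on $U\subset X$ is a function $\gamma:X\to\mathbb{R}_+\cup\{+\infty\}$ with $\gamma(x)>0$ for all $x\in U$. $\operatorname{Gr}F=\{(x,y): y\in F(x)\}$ and $F^{-1}(y)=\{x: y\in F(x)\}$. Definitions (with $\gamma$ a gauge function on $U$ and a constant $\tau>0$): - $F$ is directionally $\gamma$-regular on $U\times V$ w.r.t. $L$ and $M$ with constant $\tau$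 if for every $(x,y)\in U\times V$: $\tau T_M(y,F(x))<\gamma(x)\Rightarrow T_L(x,F^{-1}(y))\le\tau T_M(y,F(x))$. - $F^{-1}:Y\rightrightarrows X$ is directionally $\gamma$-Aubin continuous on $V\times U$ w.r.t. $M$ and $L$ with constant $\tau$ if for every $y\in V$, $v\in Y$ and $x\in F^{-1}(v)\cap U$: $\tau T_M(y,v)<\gamma(x)\Rightarrow T_L(x,F^{-1}(y))\le\tau T_M(y,v)$. - $F$ is directionally $\gamma$-open on $U\times V$ w.r.t. $L$ and $M$ with constant $\kappa>0$ if for every $(x,y)\in(U\times Y)\cap\operatorname{Gr}F$ and every $t\in(0,\gamma(x))$: $\mathbf{B}(y,\kappa t)\cap V\cap[y-\operatorname{cone}M]\subset F\bigl(\mathbf{B}(x,t)\cap[x+\operatorname{cone}L]\bigr)$. Thus, with constant $\kappa=\tau^{-1}$, the ball on the left is $\mathbf{B}(y,\tau^{-1}t)$. *)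

(* Defs.v *)
From HB Require Import structures.
From mathcomp Require Import all_boot all_order all_algebra.
From mathcomp Require Import all_classical all_reals all_analysis.

Set Implicit Arguments.
Unset Strict Implicit.
Unset Printing Implicit Defensive.

Import Order.TTheory GRing.Theory Num.Theory.
Import numFieldNormedType.Exports.

Local Open Scope classical_set_scope.
Local Open Scope ring_scope.

Definition unit_sphere (R : realType) (Z : normedModType R) : set Z :=
  [set z | `|z| = 1].
Arguments unit_sphere {R} Z.

Definition cone (R : realType) (Z : normedModType R) (A : set Z) : set Z :=
  [set z | exists t a, [/\ 0 <= t, A a & z = t *: a]].

(* The value is +oo when no admissible time exists: [ereal_inf set0 = +oo]. *)
Definition min_time (R : realType) (Z : normedModType R) (L : set Z)
    (x : Z) (A : set Z) : \bar R :=
  ereal_inf [set t%:E | t in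
    [set t : R | 0 <= t /\ [set x + t *: l | l in L] `&` A !=set0]].

Definition gauge_on (R : realType) (X : normedModType R)
    (U : set X) (gamma : X -> \bar R) : Prop :=
  (forall x, (0 <= gamma x)%E) /\ (forall x, U x -> (0 < gamma x)%E).

Definition sv_inverse (X Y : Type) (F : X -> set Y) : Y -> set X :=
  fun y => [set x | F x y].

Definition sv_graph (X Y : Type) (F : X -> set Y) : set (X * Y) :=
  [set p | F p.1 p.2].

Definition sv_image (X Y : Type) (F : X -> set Y) (A : set X) : set Y :=
  \bigcup_(x in A) F x.

Definition dir_regular (R : realType) (X Y : normedModType R)
    (F : X -> set Y) (gamma : X -> \bar R) (U : set X) (V : set Y)
    (L : set X) (M : set Y) (tau : R) : Prop :=
  forall x y, (U `*` V) (x, y) ->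
    (tau%:E * min_time M y (F x) < gamma x)%E ->
    (min_time L x (sv_inverse F y) <= tau%:E * min_time M y (F x))%E.

(* Stated for an arbitrary G from Y to X; the gauge lives on the target X. *)
Definition dir_aubin (R : realType) (X Y : normedModType R)
    (G : Y -> set X) (gamma : X -> \bar R) (V : set Y) (U : set X)
    (M : set Y) (L : set X) (tau : R) : Prop :=
  forall y v x, V y -> (G v `&` U) x ->
    (tau%:E * min_time M y [set v] < gamma x)%E ->
    (min_time L x (G y) <= tau%:E * min_time M y [set v])%E.

Definition dir_open (R : realType) (X Y : normedModType R)
    (F : X -> set Y) (gamma : X -> \bar R) (U : set X) (V : set Y)
    (L : set X) (M : set Y) (kappa : R) : Prop :=
  forall x y, ((U `*` setT) `&` sv_graph F) (x, y) ->
  forall t : R, 0 < t -> (t%:E < gamma x)%E ->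
    ball y (kappa * t) `&` V `&` [set y - c | c in cone M]
    `<=` sv_image F (ball x t `&` [set x + c | c in cone L]).

(* Main.v *)
(* Since the directions are unit vectors, [T_L(x, A) < t] holds exactly when [A]
   meets [ball x t] inside [x + cone L]; this turns the openness inclusions into
   strict inequalities between minimal times.  The cycle is regular -> Aubin ->
   open -> regular: the first step is monotonicity of [T_M(y, _)], the second
   uses [T_M(y - s m, y) <= s], and the last lets [t] decrease
   to [tau * T_M(y, F x)]. *)

Require Import Defs.
From HB Require Import structures.
From mathcomp Require Import all_boot all_order all_algebra.
From mathcomp Require Import all_classical all_reals all_analysis.

Import Order.TTheory GRing.Theory Num.Theory.
Import numFieldNormedType.Exports.

Local Open Scope classical_set_scope.
Local Open Scope ring_scope.

(** Openness quantifies over real [t], whereas gauges and minimal times may be infinite; this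
    supplies a real time strictly between two such values. *)
Lemma ereal_dense (R : realFieldType) (a b : \bar R) :
  (a < b)%E -> exists r : R, (a < r%:E)%E /\ (r%:E < b)%E.
Proof.
case: a b => [a| |] [b| |] //=.
- by rewrite lte_fin => /midf_lt[ar rb]; exists ((a + b) / 2); rewrite !lte_fin.
- by move=> _; exists (a + 1); rewrite lte_fin ltrDl ltr01 ltry.
- by move=> _; exists (b - 1); rewrite lte_fin gtrBl ltr01 ltNyr.
- by move=> _; exists 0; rewrite ltNyr ltry.
Qed.

Lemma min_time_le {R : realType} {Z : normedModType R} {L A : set Z} {x : Z}
    (l : Z) {s : R} : 0 <= s -> L l -> A (x + s *: l) -> (min_time L x A <= s%:E)%E.
Proof.
move=> s0 Ll Al; apply: ereal_inf_lbound; exists s => //.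
by split=> //; exists (x + s *: l); split=> //; exists l.
Qed.

(** The infimum may fail to be attained, so an actual time and direction are extracted only from a
    strict bound. *)
Lemma min_time_lt (R : realType) (Z : normedModType R) (L A : set Z) (x : Z)
    (e : \bar R) : (min_time L x A < e)%E ->
  exists s l, [/\ 0 <= s, L l, A (x + s *: l) & (s%:E < e)%E].
Proof.
move=> /ereal_inf_lt[_ [s [s0 [_ [[l Ll <-] Al]]] <-] se].
by exists s, l; split.
Qed.

Lemma min_time_ge0 (R : realType) (Z : normedModType R) (L A : set Z) (x : Z) :
  (0 <= min_time L x A)%E.
Proof.
by apply/ereal_infP => _ [s [s0 _] <-]; rewrite lee_fin.
Qed.

Lemma min_time_subset (R : realType) (Z : normedModType R) (L A B : set Z)
    (x : Z) : A `<=` B -> (min_time L x B <= min_time L x A)%E.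
Proof.
move=> AB; apply: ereal_inf_le_tmp => _ [s [s0 [z [Lz Az]]] <-].
by exists s => //; split=> //; exists z; split=> //; exact: AB.
Qed.

Lemma norm_scale_sphere {R : realType} {Z : normedModType R} {z : Z} {s : R} :
  unit_sphere Z z -> 0 <= s -> `|s *: z| = s.
Proof. by move=> z1 s0; rewrite normrZ z1 mulr1 ger0_norm. Qed.

Section Implications.
Context {R : realType} {X Y : normedModType R} {F : X -> set Y}.
Context {L : set X} {M : set Y} {U : set X} {V : set Y}.
Context {gamma : X -> \bar R} {tau : R}.
Hypotheses (LS : L `<=` unit_sphere X) (MS : M `<=` unit_sphere Y).
Hypothesis tau0 : 0 < tau.

Lemma dir_regular_aubin : dir_regular F gamma U V L M tau ->
  dir_aubin (sv_inverse F) gamma V U M L tau.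
Proof.
move=> reg y v x Vy [Fxv Ux] lt_gamma.
(* As [v] lies in [F x], monotonicity applies. It serves twice: to bring the regularity premise
   below [gamma x], and to weaken its conclusion. *)
have le_tau : (tau%:E * min_time M y (F x)
               <= tau%:E * min_time M y [set v])%E.
  apply: lee_wpmul2l; first by rewrite lee_fin ltW.
  by apply: min_time_subset => _ ->.
by apply: (le_trans _ le_tau); apply: reg => //; exact: le_lt_trans lt_gamma.
Qed.

Lemma dir_aubin_open : dir_aubin (sv_inverse F) gamma V U M L tau ->
  dir_open F gamma U V L M tau^-1.
Proof.
move=> aubin x y [[/= Ux _] Fxy] t t0 tgamma z.
move=> [[yz Vz] [_ [s [m [s0 Mm ->]]] zE]].
(* Here [z = y - s *: m] with [m] a unit vector, so [z] is at distance exactly [s] from [y]. *)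
have s_lt : tau * s < t.
  move: yz; rewrite -ball_normE /= -zE opprB addrC subrK.
  by rewrite (norm_scale_sphere (MS _ Mm)) // ltr_pdivlMl.
have Tzy : (tau%:E * min_time M z [set y] <= (tau * s)%:E)%E.
  rewrite EFinM; apply: lee_wpmul2l; first by rewrite lee_fin ltW.
  by apply: (min_time_le m) => //=; rewrite -zE subrK.
have Tzy_lt : (tau%:E * min_time M z [set y] < t%:E)%E.
  by apply: le_lt_trans Tzy _; rewrite lte_fin.
(* The roles swap: [z] is the value to be reached and [y] the known value at [x]. The strict bound
   by [t] puts the point found in the open ball. *)
have := aubin z y x Vz (conj Fxy Ux) (lt_trans Tzy_lt tgamma).
move=> /le_lt_trans /(_ Tzy_lt) /min_time_lt[r [l [r0 Ll Fl]]].
rewrite lte_fin => rt.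
exists (x + r *: l) => //; split; last by exists (r *: l) => //; exists r, l.
by rewrite -ball_normE /= opprD addNKr normrN (norm_scale_sphere (LS _ Ll)).
Qed.

Lemma dir_open_regular : dir_open F gamma U V L M tau^-1 ->
  dir_regular F gamma U V L M tau.
Proof.
move=> op x y [/= Ux Vy] lt_gamma.
have T0 : (0 <= tau%:E * min_time M y (F x))%E.
  by apply: mule_ge0; [rewrite lee_fin ltW|exact: min_time_ge0].
have reach (t : R) : (tau%:E * min_time M y (F x) < t%:E)%E ->
    (t%:E < gamma x)%E -> (min_time L x (sv_inverse F y) <= t%:E)%E.
  move=> Tt tgamma.
  have t0 : 0 < t by rewrite -lte_fin; exact: le_lt_trans Tt.
  have : (min_time M y (F x) < (tau^-1 * t)%:E)%E.
    by rewrite EFinM lte_pdivlMl.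
  move=> /min_time_lt[s [m [s0 Mm Fv]]]; rewrite lte_fin => st.
  (* Openness is applied at the value [y + s *: m] of [F x], with target [y]; only the target has to
     lie in [V]. *)
  have [//||x' [xx' [_ [r [l [r0 Ll ->]]] x'E]] Fx'y] :=
    op x (y + s *: m) _ t t0 tgamma y.
    split; [split=> //|].
      by rewrite -ball_normE /= addrC addKr (norm_scale_sphere (MS _ Mm)).
    by exists (s *: m); [exists s, m|rewrite addrK].
  move: xx'; rewrite -ball_normE /= -x'E opprD addNKr normrN.
  rewrite (norm_scale_sphere (LS _ Ll)) // => rt.
  apply: (@le_trans _ _ r%:E); last by rewrite lee_fin ltW.
  by apply: (min_time_le l) => //; rewrite x'E.
rewrite leNgt; apply/negP => gt_T.
(* Were the conclusion false, some real [t] above [tau * T_M(y, F x)] would lie below both [gamma x]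
   and the minimal time to the inverse image, contradicting [reach]. *)
have [t] : exists t : R, (tau%:E * min_time M y (F x) < t%:E)%E /\
    (t%:E < mine (gamma x) (min_time L x (sv_inverse F y)))%E.
  by apply: ereal_dense; rewrite lt_min lt_gamma.
rewrite lt_min => -[Tt /andP[tgamma /lt_geF]].
by rewrite reach.
Qed.

End Implications.

Theorem proposition2p6 (R : realType) (X Y : normedModType R)
    (F : X -> set Y) (L : set X) (M : set Y) (U : set X) (V : set Y)
    (gamma : X -> \bar R) (tau : R)
    (L0 : L !=set0) (LS : L `<=` unit_sphere X)
    (M0 : M !=set0) (MS : M `<=` unit_sphere Y)
    (U0 : U !=set0) (V0 : V !=set0)
    (hgamma : gauge_on U gamma) (tau0 : 0 < tau) :
  (dir_regular F gamma U V L M tau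
     <-> dir_aubin (sv_inverse F) gamma V U M L tau) /\
  (dir_aubin (sv_inverse F) gamma V U M L tau
     <-> dir_open F gamma U V L M tau^-1).
Proof.
split; split.
- exact: dir_regular_aubin.
- by move=> /(dir_aubin_open LS MS tau0); exact: dir_open_regular.
- exact: dir_aubin_open.
- by move=> /(dir_open_regular LS MS tau0); exact: dir_regular_aubin.
Qed.
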